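(* Let $F$ be a contravariant functor from the category of unital $C^*$-algebras to the category of sets whose restriction to the full subcategory of commutative unital $C^*$-algebras is isomorphic to the Gelfand spectrum functor $\operatorname{Gelf}$. Then $F(\mathrm{M}_n(\mathbb{C})) = \varnothing$ for every $n \geq 3$.
   Context: The morphisms of the category of unital $C^*$-algebras are identity-preserving $*$-homomorphisms. For a commutative unital $C^*$-algebra $A$, $\operatorname{Gelf}(A)$ is the set of maximal ideals of $A$; a morphism $f\colon A\to B$ is sent to the map $\operatorname{Gelf}(B)\to\operatorname{Gelf}(A)$, $M\mapsto f^{-1}(M)$. $\mathrm{M}_n(\mathbb{C})$ is the $C^*$-algebra of $n\times n$ complex matrices. *)

(* Defs.v *)
From HB Require Import structures.
From mathcomp Require Import all_boot all_algebra.
From mathcomp Require Import Rstruct complex.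

Set Implicit Arguments.
Unset Strict Implicit.
Unset Printing Implicit Defensive.

Import GRing.Theory Num.Theory.
Local Open Scope ring_scope.

Definition Rr := Rdefinitions.R.
Definition C : numClosedFieldType := Rr[i].
Definition modC (a : C) : Rr := Normc.normc a.

Record CStarAlg := {
  cs_car :> pzRingType;
  cs_scale : C -> cs_car -> cs_car;
  cs_star : cs_car -> cs_car;
  cs_norm : cs_car -> Rr;
  cs_scale1 : forall x, cs_scale 1 x = x;
  cs_scaleA : forall a b x, cs_scale a (cs_scale b x) = cs_scale (a * b) x;
  cs_scaleDl : forall a b x, cs_scale (a + b) x = cs_scale a x + cs_scale b x;
  cs_scaleDr : forall a x y, cs_scale a (x + y) = cs_scale a x + cs_scale a y;
  cs_scaleAl : forall a x y, cs_scale a (x * y) = cs_scale a x * y;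
  cs_scaleAr : forall a x y, cs_scale a (x * y) = x * cs_scale a y;
  cs_starD : forall x y, cs_star (x + y) = cs_star x + cs_star y;
  cs_starZ : forall a x, cs_star (cs_scale a x) = cs_scale (conjc a) (cs_star x);
  cs_starM : forall x y, cs_star (x * y) = cs_star y * cs_star x;
  cs_starK : forall x, cs_star (cs_star x) = x;
  cs_norm_ge0 : forall x, 0 <= cs_norm x;
  cs_norm_eq0 : forall x, cs_norm x = 0 -> x = 0;
  cs_normD : forall x y, cs_norm (x + y) <= cs_norm x + cs_norm y;
  cs_normZ : forall a x, cs_norm (cs_scale a x) = modC a * cs_norm x;
  cs_normM : forall x y, cs_norm (x * y) <= cs_norm x * cs_norm y;
  cs_norm_cstar : forall x, cs_norm (cs_star x * x) = cs_norm x ^+ 2;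
  cs_complete : forall u : nat -> cs_car,
    (forall e : Rr, 0 < e -> exists N : nat, forall m n : nat,
        (N <= m)%N -> (N <= n)%N -> cs_norm (u m - u n) < e) ->
    exists l : cs_car, forall e : Rr, 0 < e -> exists N : nat, forall n : nat,
        (N <= n)%N -> cs_norm (u n - l) < e
}.

Record hom (A B : CStarAlg) := Hom {
  hom_fun :> A -> B;
  hom_add : forall x y, hom_fun (x + y) = hom_fun x + hom_fun y;
  hom_mul : forall x y, hom_fun (x * y) = hom_fun x * hom_fun y;
  hom_one : hom_fun 1 = 1;
  hom_scale : forall a x, hom_fun (cs_scale a x) = cs_scale a (hom_fun x);
  hom_star : forall x, hom_fun (cs_star x) = cs_star (hom_fun x)
}.

Definition hom_id (A : CStarAlg) : hom A A.
Proof. by apply: (@Hom A A id). Defined.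

Definition hom_comp (A B D : CStarAlg) (g : hom B D) (f : hom A B) : hom A D.
Proof.
apply: (@Hom A D (fun x => g (f x))).
- by move=> x y; rewrite !hom_add.
- by move=> x y; rewrite !hom_mul.
- by rewrite !hom_one.
- by move=> a x; rewrite !hom_scale.
- by move=> x; rewrite !hom_star.
Defined.

Record CFunctor := {
  Fob : CStarAlg -> Type;
  Fmap : forall A B : CStarAlg, hom A B -> Fob B -> Fob A;
  Fmap_id : forall (A : CStarAlg) (x : Fob A), Fmap (hom_id A) x = x;
  Fmap_comp : forall (A B D : CStarAlg) (f : hom A B) (g : hom B D) (x : Fob D),
      Fmap (hom_comp g f) x = Fmap f (Fmap g x)
}.

Definition commutative_cstar (A : CStarAlg) : Prop := forall x y : A, x * y = y * x.

Definition is_ideal (A : CStarAlg) (I : A -> Prop) : Prop :=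
  [/\ I 0,
      (forall x y, I x -> I y -> I (x + y)),
      (forall a x, I x -> I (a * x)) &
      (forall a x, I x -> I (x * a))].

Definition proper_ideal (A : CStarAlg) (I : A -> Prop) : Prop :=
  is_ideal I /\ ~ I 1.

Definition maximal_ideal (A : CStarAlg) (I : A -> Prop) : Prop :=
  proper_ideal I /\
  (forall J : A -> Prop, proper_ideal J -> (forall x, I x -> J x) -> forall x, J x -> I x).

Definition Gelf (A : CStarAlg) : Type := {I : A -> Prop | maximal_ideal I}.

(* Gelf on morphisms: M |-> f^{-1}(M) (stated on the underlying subsets). *)
Definition preim_ideal (A B : CStarAlg) (f : hom A B) (M : B -> Prop) : A -> Prop :=
  fun x => M (f x).

Definition restricts_to_Gelf (F : CFunctor) : Prop :=
  exists eta : forall A : CStarAlg, commutative_cstar A -> Fob F A -> Gelf A,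
    (forall (A : CStarAlg) (hA : commutative_cstar A), bijective (eta A hA)) /\
    (forall (A B : CStarAlg) (hA : commutative_cstar A) (hB : commutative_cstar B)
            (f : hom A B) (x : Fob F B),
        proj1_sig (eta A hA (@Fmap F A B f x)) = preim_ideal f (proj1_sig (eta B hB x))).

Definition adjmx (n : nat) (M : 'M[C]_n) : 'M[C]_n := map_mx conjc M^T.

Definition is_Mn (n : nat) (A : CStarAlg) : Prop :=
  exists phi : A -> 'M[C]_n,
    bijective phi /\
    [/\ (forall x y, phi (x + y) = phi x + phi y),
        (forall x y, phi (x * y) = phi x *m phi y),
        phi 1 = 1%:M,
        (forall a x, phi (cs_scale a x) = a *: phi x) &
        (forall x, phi (cs_star x) = adjmx (phi x))].

(* Main.v *)
(** A point x of F(A) restricts along every morphism h from a commutative algebra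
    B to A to a point of F(B), that is, to a maximal ideal of B, compatibly in B.
    Taking B = C^T, a self-adjoint partition of unity in A is a morphism C^T -> A,
    and the maximal ideal singles out exactly one of its projections, which we call
    valued.  By naturality along C^2 -> C^T this depends on the projection alone and
    not on the partition.  For A = M_n(C) some diagonal matrix unit is valued; hence
    in a three-dimensional coordinate subspace containing it, exactly one vector of
    each orthogonal basis spans a valued line.  Already on vectors with integer
    entries of absolute value at most 2 this contradicts the Kochen-Specker theorem. *)

From mathcomp Require Import all_boot all_order all_algebra perm.
From mathcomp Require Import boolp Rstruct complex ring.
From Stdlib Require Rseries Rcomplete.
Require Import Defs.

Set Implicit Arguments.
Unset Strict Implicit.
Unset Printing Implicit Defensive.

Import Order.TTheory GRing.Theory Num.Theory.
Local Open Scope ring_scope.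

(** * Modulus and completeness of the complex numbers *)

Lemma modC_ge0 (z : C) : 0 <= modC z.
Proof. by case: z => a b; apply: sqrtr_ge0. Qed.

Lemma modCM (z w : C) : modC (z * w) = modC z * modC w.
Proof. exact: Normc.normcM. Qed.

Lemma modCD (z w : C) : modC (z + w) <= modC z + modC w.
Proof. exact: le_normcD. Qed.

Lemma modCJ (z : C) : modC (conjc z) = modC z.
Proof. by case: z => a b; rewrite /modC /= sqrrN. Qed.

Lemma Re_le_modC (z : C) : `|complex.Re z| <= modC z.
Proof. by case: z => a b; rewrite -sqrtr_sqr ler_wsqrtr //= lerDl sqr_ge0. Qed.

Lemma Im_le_modC (z : C) : `|complex.Im z| <= modC z.
Proof. by case: z => a b; rewrite -sqrtr_sqr ler_wsqrtr //= lerDr sqr_ge0. Qed.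

Lemma modC_le_ReIm (z : C) : modC z <= `|complex.Re z| + `|complex.Im z|.
Proof.
case: z => a b /=; rewrite -[leRHS]ger0_norm ?addr_ge0 // -sqrtr_sqr.
rewrite ler_wsqrtr // sqrrD !real_normK ?num_real // lerD2r lerDl.
by rewrite mulrn_wge0 ?mulr_ge0.
Qed.

Definition cauchy_for (T : zmodType) (N : T -> Rr) (u : nat -> T) :=
  forall e : Rr, 0 < e -> exists n0 : nat, forall m n : nat,
    (n0 <= m)%N -> (n0 <= n)%N -> N (u m - u n) < e.

Definition converges_for (T : zmodType) (N : T -> Rr) (u : nat -> T) (l : T) :=
  forall e : Rr, 0 < e -> exists n0 : nat, forall n : nat,
    (n0 <= n)%N -> N (u n - l) < e.

Lemma Rr_complete (u : nat -> Rr) :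
  cauchy_for (fun x : Rr => `|x|) u ->
  exists l, converges_for (fun x : Rr => `|x|) u l.
Proof.
move=> cu; have /Rcomplete.R_complete[l ul] : Rseries.Cauchy_crit u.
  move=> e /RltP /cu[n0 hn0]; exists n0 => n m /ssrnat.leP hn /ssrnat.leP hm.
  by apply/RltP; rewrite RdistE hn0.
exists l => e /RltP /ul[n0 hn0]; exists n0 => n /ssrnat.leP /hn0 /RltP.
by rewrite RdistE.
Qed.

Lemma C_complete (u : nat -> C) :
  cauchy_for modC u -> exists l, converges_for modC u l.
Proof.
move=> cu.
have [|x ux] := @Rr_complete (fun n => complex.Re (u n)).
  move=> e /cu[n0 hn0]; exists n0 => m n hm hn.
  by rewrite -raddfB; apply: le_lt_trans (hn0 m n hm hn); apply: Re_le_modC.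
have [|y uy] := @Rr_complete (fun n => complex.Im (u n)).
  move=> e /cu[n0 hn0]; exists n0 => m n hm hn.
  by rewrite -raddfB; apply: le_lt_trans (hn0 m n hm hn); apply: Im_le_modC.
exists (Complex x y) => e e0.
have /ux[n1 h1] : 0 < e / 2 by rewrite divr_gt0.
have /uy[n2 h2] : 0 < e / 2 by rewrite divr_gt0.
exists (maxn n1 n2) => n; rewrite geq_max => /andP[/h1 r1 /h2 r2].
apply: le_lt_trans (modC_le_ReIm _) _.
by rewrite !raddfB /= [ltRHS]splitr ltrD.
Qed.

(** * The commutative C*-algebra C^T for a finite set T *)

Section FiniteProduct.
Variable T : finType.
Implicit Types f g : {ffun T -> C}.

(** Moduli are nonnegative, so starting the maximum at 0 changes nothing for inhabited [T] and gives
    the norm of the zero algebra for empty [T]. *)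
Definition ffun_norm f : Rr := \big[Num.max/0]_t modC (f t).
Definition ffun_star f : {ffun T -> C} := [ffun t => conjc (f t)].
Definition ffun_scaleC (a : C) f : {ffun T -> C} := [ffun t => a * f t].

Lemma ffun_norm_ge0 f : 0 <= ffun_norm f.
Proof. exact: bigmax_ge_id. Qed.

Lemma modC_le_norm f t : modC (f t) <= ffun_norm f.
Proof. exact: le_bigmax. Qed.

Lemma ffun_norm_le f r :
  0 <= r -> (forall t, modC (f t) <= r) -> ffun_norm f <= r.
Proof. by move=> r0 fr; apply: bigmax_le. Qed.

Lemma ffun_norm_lt f r :
  0 < r -> (forall t, modC (f t) < r) -> ffun_norm f < r.
Proof. by move=> r0 fr; apply: bigmax_lt. Qed.

Lemma ffun_norm_eq0 f : ffun_norm f = 0 -> f = 0.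
Proof.
move=> f0; apply/ffunP => t; rewrite ffunE; apply: Normc.eq0_normc.
by apply/le_anti; rewrite -[X in _ <= X]f0 modC_le_norm modC_ge0.
Qed.

Lemma ffun_normD f g : ffun_norm (f + g) <= ffun_norm f + ffun_norm g.
Proof.
apply: ffun_norm_le => [|t]; first by rewrite addr_ge0 ?ffun_norm_ge0.
by rewrite ffunE (le_trans (modCD _ _)) // lerD ?modC_le_norm.
Qed.

Lemma ffun_normZ a f : ffun_norm (ffun_scaleC a f) = modC a * ffun_norm f.
Proof.
rewrite /ffun_norm [RHS](big_morph _ (fun x y => maxr_pMr x y (modC_ge0 a)) (mulr0 _)).
by apply: eq_bigr => t _; rewrite ffunE modCM.
Qed.

Lemma ffun_normM f g : ffun_norm (f * g) <= ffun_norm f * ffun_norm g.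
Proof.
apply: ffun_norm_le => [|t]; first by rewrite mulr_ge0 ?ffun_norm_ge0.
by rewrite ffunE modCM ler_pM ?modC_ge0 ?modC_le_norm.
Qed.

Lemma ffun_norm_cstar f : ffun_norm (ffun_star f * f) = ffun_norm f ^+ 2.
Proof.
have sqE t : modC ((ffun_star f * f) t) = modC (f t) ^+ 2.
  by rewrite !ffunE modCM modCJ expr2.
apply/le_anti/andP; split.
  apply: ffun_norm_le => [|t]; first exact: sqr_ge0.
  by rewrite sqE lerXn2r ?nnegrE ?modC_ge0 ?ffun_norm_ge0 ?modC_le_norm.
(* Conversely, each modulus of [f] is the square root of one of [ffun_star f * f], so the square
   root of the norm of that product bounds [f]. *)
rewrite -[leRHS]sqr_sqrtr ?ffun_norm_ge0 //.
rewrite lerXn2r ?nnegrE ?ffun_norm_ge0 ?sqrtr_ge0 //.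
apply: ffun_norm_le => [|t]; first exact: sqrtr_ge0.
rewrite -[leLHS]ger0_norm ?modC_ge0 // -sqrtr_sqr ler_wsqrtr // -sqE.
exact: modC_le_norm.
Qed.

Lemma ffun_complete (u : nat -> {ffun T -> C}) :
  cauchy_for ffun_norm u -> exists l, converges_for ffun_norm u l.
Proof.
move=> cu.
have /choice[l hl] t : exists z, converges_for modC (fun n => u n t) z.
  apply: C_complete => e /cu[n0 hn0]; exists n0 => m n hm hn.
  apply: le_lt_trans (hn0 m n hm hn).
  by have := modC_le_norm (u m - u n) t; rewrite !ffunE.
exists (finfun l) => e e0.
(* Each coordinate has its own rank of convergence; finiteness of [T] allows their maximum. *)
have /choice[n0 hn0] t := hl t e e0.
exists (\max_t n0 t) => n hn; apply: ffun_norm_lt => // t.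
by rewrite !ffunE; apply: hn0; apply: leq_trans hn; apply: leq_bigmax.
Qed.

Definition ffun_cstar : CStarAlg.
Proof.
refine (@Build_CStarAlg ({ffun T -> C} : pzRingType) ffun_scaleC ffun_star ffun_norm
  _ _ _ _ _ _ _ _ _ _ ffun_norm_ge0 ffun_norm_eq0 ffun_normD ffun_normZ
  ffun_normM ffun_norm_cstar ffun_complete).
- by move=> f; apply/ffunP => t; rewrite !ffunE mul1r.
- by move=> a b f; apply/ffunP => t; rewrite !ffunE mulrA.
- by move=> a b f; apply/ffunP => t; rewrite !ffunE mulrDl.
- by move=> a f g; apply/ffunP => t; rewrite !ffunE mulrDr.
- by move=> a f g; apply/ffunP => t; rewrite !ffunE mulrA.
- by move=> a f g; apply/ffunP => t; rewrite !ffunE mulrCA.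
- by move=> f g; apply/ffunP => t; rewrite !ffunE raddfD.
- by move=> a f; apply/ffunP => t; rewrite !ffunE rmorphM.
- by move=> f g; apply/ffunP => t; rewrite !ffunE rmorphM mulrC.
- by move=> f; apply/ffunP => t; rewrite !ffunE conjcK.
Defined.

Lemma ffun_cstar_comm : commutative_cstar ffun_cstar.
Proof. by move=> f g; apply/ffunP => t; rewrite !ffunE mulrC. Qed.

End FiniteProduct.

(** * Elementary facts on C*-algebras, morphisms and maximal ideals *)

Section CStarAlgTheory.
Variable A : CStarAlg.
Implicit Types (a : C) (x y : A).

Lemma cs_scale0l x : cs_scale 0 x = 0.
Proof. by apply: (addIr (cs_scale 0 x)); rewrite -cs_scaleDl !add0r. Qed.

Lemma cs_scale0r a : cs_scale a (0 : A) = 0.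
Proof. by apply: (addIr (cs_scale a 0)); rewrite -cs_scaleDr !add0r. Qed.

Lemma cs_star0 : cs_star (0 : A) = 0.
Proof. by apply: (addIr (cs_star 0)); rewrite -cs_starD !add0r. Qed.

Lemma cs_star1 : cs_star (1 : A) = 1.
Proof. by rewrite -[LHS]mulr1 -{2}[1]cs_starK -cs_starM mulr1 cs_starK. Qed.

Lemma cs_starN x : cs_star (- x) = - cs_star x.
Proof. by apply: (addIr (cs_star x)); rewrite -cs_starD !addNr cs_star0. Qed.

Lemma cs_scale_sum a (I : finType) (f : I -> A) :
  cs_scale a (\sum_i f i) = \sum_i cs_scale a (f i).
Proof. exact: (big_morph _ (@cs_scaleDr A a) (cs_scale0r a)). Qed.

Lemma cs_star_sum (I : finType) (f : I -> A) :
  cs_star (\sum_i f i) = \sum_i cs_star (f i).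
Proof. exact: (big_morph _ (@cs_starD A) cs_star0). Qed.

End CStarAlgTheory.

(** [Fmap] acts on whole records, so morphisms with the same values must be equal before their
    actions on points can be identified. *)
Lemma hom_ext (A B : CStarAlg) (f g : hom A B) : f =1 g -> f = g.
Proof.
case: f g => [f fD fM f1 fZ fS] [g gD gM g1 gZ gS] /= /funext fg.
by case: g / fg gD gM g1 gZ gS => *; congr Hom; apply: Prop_irrelevance.
Qed.

(* [fun x => M (x * b)] is an ideal containing [M] and [a]; it is proper since [M]
   does not contain [b]. *)
Lemma maximal_ideal_prime (A : CStarAlg) (M : A -> Prop) (a b : A) :
  commutative_cstar A -> maximal_ideal M -> M (a * b) -> ~ M b -> M a.
Proof.
move=> cA [[[M0 MD Ml Mr] _] maxM] Mab Mb.
apply: (maxM (fun x => M (x * b))) => [|x Mx|] //; last exact: Mr.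
split; last by rewrite mul1r.
split=> [|x y Mx My|c x Mx|c x Mx].
- by rewrite mul0r.
- by rewrite mulrDl; apply: MD.
- by rewrite -mulrA; apply: Ml.
- by rewrite (cA x) -mulrA; apply: Ml.
Qed.

(** * Morphisms out of C^T and partitions of unity *)

Definition point (T : finType) (t : T) : ffun_cstar T :=
  [ffun s => (s == t)%:R] : {ffun T -> C}.

Lemma sum_point (T : finType) : \sum_t point t = 1 :> ffun_cstar T.
Proof.
apply/ffunP => s; rewrite sum_ffunE ffunE (bigD1 s) //= big1 ?addr0 ?ffunE ?eqxx //.
by move=> t /negPf st; rewrite ffunE eq_sym st.
Qed.

Lemma point_mul (T : finType) (s t : T) : s != t -> point s * point t = 0.
Proof.
move=> /negPf st; apply/ffunP => r; rewrite !ffunE.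
by case: eqP => [->|]; rewrite ?st ?mulr0 ?mul0r.
Qed.

Definition ffun_pullback (T T' : finType) (r : T' -> T) :
  hom (ffun_cstar T) (ffun_cstar T').
Proof.
apply: (@Hom (ffun_cstar T) (ffun_cstar T')
         (fun f : {ffun T -> C} => [ffun t => f (r t)] : {ffun T' -> C})).
- by move=> f g; apply/ffunP => t; rewrite !ffunE.
- by move=> f g; apply/ffunP => t; rewrite !ffunE.
- by apply/ffunP => t; rewrite !ffunE.
- by move=> a f; apply/ffunP => t; rewrite !ffunE.
- by move=> f; apply/ffunP => t; rewrite !ffunE.
Defined.

(** The test for equality with [t] maps [T] to [bool]; its dual C^2 -> C^T is the morphism along
    which naturality is applied. *)
Lemma ffun_pullback_point (T : finType) (t : T) :
  ffun_pullback (fun s => s == t) (point true) = point t.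
Proof. by apply/ffunP => s; rewrite !ffunE eqb_id. Qed.

(** C^2 is spanned by 1 and [point true]. *)
Lemma hom_bool_ext (A : CStarAlg) (h h' : hom (ffun_cstar bool) A) :
  h (point true) = h' (point true) -> h = h'.
Proof.
move=> hh'; apply: hom_ext => f.
have -> : f = cs_scale (f false) 1 + cs_scale (f true - f false) (point true).
  apply/ffunP => -[]; rewrite !ffunE /= ?mulr1 ?mulr0 ?addr0 //.
  by rewrite addrC subrK.
by rewrite !hom_add !hom_scale !hom_one hh'.
Qed.

Definition partition_of_unity (A : CStarAlg) (T : finType) (p : T -> A) : Prop :=
  [/\ forall t, cs_star (p t) = p t,
      forall s t, p s * p t = if s == t then p t else 0 &
      \sum_t p t = 1].

(** The linear extension of [p] is multiplicative by orthogonality and idempotence, unital since the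
    [p t] sum to 1, and preserves the star since they are self-adjoint. *)
Lemma partition_hom (A : CStarAlg) (T : finType) (p : T -> A) :
  partition_of_unity p ->
  exists h : hom (ffun_cstar T) A, forall t, h (point t) = p t.
Proof.
move=> [pS pM p1].
pose h (f : {ffun T -> C}) := \sum_t cs_scale (f t) (p t).
have hD (f g : {ffun T -> C}) : h (f + g) = h f + h g.
  by rewrite -big_split; apply: eq_bigr => t _; rewrite ffunE cs_scaleDl.
have hM (f g : {ffun T -> C}) : h (f * g) = h f * h g.
  rewrite mulr_suml; apply: eq_bigr => s _.
  rewrite -cs_scaleAl mulr_sumr (bigD1 s) //= big1 => [|t ts]; last first.
    by rewrite -cs_scaleAr pM eq_sym (negPf ts) cs_scale0r.
  by rewrite addr0 -cs_scaleAr pM eqxx ffunE cs_scaleA.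
have h1 : h 1 = 1.
  by rewrite -p1; apply: eq_bigr => t _; rewrite ffunE cs_scale1.
have hZ a (f : {ffun T -> C}) : h (ffun_scaleC a f) = cs_scale a (h f).
  by rewrite cs_scale_sum; apply: eq_bigr => t _; rewrite ffunE cs_scaleA.
have hS (f : {ffun T -> C}) : h (ffun_star f) = cs_star (h f).
  by rewrite cs_star_sum; apply: eq_bigr => t _; rewrite ffunE cs_starZ pS.
exists (@Hom (ffun_cstar T) A h hD hM h1 hZ hS) => t /=.
rewrite /h (bigD1 t) //= ffunE eqxx cs_scale1 big1 ?addr0 // => s /negPf st.
by rewrite ffunE st cs_scale0l.
Qed.

(** * The projections valued at a point of F(A) *)

Section Valuation.
Variable F : CFunctor.
Variable eta : forall A : CStarAlg, commutative_cstar A -> Fob F A -> Gelf A.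
Hypothesis eta_natural :
  forall (A B : CStarAlg) (hA : commutative_cstar A) (hB : commutative_cstar B)
         (f : hom A B) (x : Fob F B),
    proj1_sig (eta hA (Fmap f x)) = preim_ideal f (proj1_sig (eta hB x)).
Variables (A : CStarAlg) (x : Fob F A).

Definition ideal_of (T : finType) (h : hom (ffun_cstar T) A) :
    ffun_cstar T -> Prop :=
  proj1_sig (eta (@ffun_cstar_comm T) (Fmap h x)).

Lemma ideal_of_maximal (T : finType) (h : hom (ffun_cstar T) A) :
  maximal_ideal (ideal_of h).
Proof. exact: proj2_sig. Qed.

Lemma ideal_of_comp (T T' : finType) (h : hom (ffun_cstar T') A)
    (g : hom (ffun_cstar T) (ffun_cstar T')) :
  ideal_of (hom_comp h g) = preim_ideal g (ideal_of h).
Proof. by rewrite /ideal_of Fmap_comp (eta_natural _ (@ffun_cstar_comm T')). Qed.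

Definition valued (a : A) : Prop :=
  exists2 h : hom (ffun_cstar bool) A,
    h (point true) = a & ~ ideal_of h (point true).

(** Composing [h] with the dual of the test for [t] gives a morphism from C^2, the only one sending
    [point true] to [h (point t)]; naturality identifies the two membership questions. *)
Lemma valued_hom (T : finType) (h : hom (ffun_cstar T) A) (t : T) :
  valued (h (point t)) <-> ~ ideal_of h (point t).
Proof.
pose g := ffun_pullback (fun s => s == t).
have gE : hom_comp h g (point true) = h (point t).
  exact: congr1 (ffun_pullback_point t).
have idE : ideal_of (hom_comp h g) (point true) = ideal_of h (point t).
  by rewrite ideal_of_comp /preim_ideal ffun_pullback_point.
split=> [[h' h'E]|ht]; last by exists (hom_comp h g); rewrite ?idE.
by rewrite (@hom_bool_ext _ h' (hom_comp h g)) ?idE // gE.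
Qed.

(** An ideal containing every [point t] would contain their sum 1. *)
Lemma valued_partition_ex (T : finType) (p : T -> A) :
  partition_of_unity p -> exists t, valued (p t).
Proof.
move=> /partition_hom[h hp]; apply: contrapT => nv.
have [[[M0 MD _ _] M1] _] := ideal_of_maximal h.
apply: M1; rewrite -sum_point; elim/big_ind: _ => // t _.
by apply: contrapT => /valued_hom; rewrite hp => vt; apply: nv; exists t.
Qed.

(** Distinct points have product 0, which lies in the ideal; as a maximal ideal is prime, it
    contains one of them. *)
Lemma valued_partition_inj (T : finType) (p : T -> A) (s t : T) :
  partition_of_unity p -> valued (p s) -> valued (p t) -> s = t.
Proof.
move=> /partition_hom[h hp]; rewrite -!hp => /valued_hom vs /valued_hom vt.
have [//|st] := eqVneq s t; case: vs.
apply: (maximal_ideal_prime (@ffun_cstar_comm T) (ideal_of_maximal h) _ vt).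
by rewrite point_mul //; have [[[]]] := ideal_of_maximal h.
Qed.

End Valuation.

(** * The Kochen-Specker contradiction on integer vectors *)

Definition vec : Type := (int * int * int)%type.

Definition vdot (u v : vec) : int :=
  u.1.1 * v.1.1 + u.1.2 * v.1.2 + u.2 * v.2.

Definition vcross (u v : vec) : vec :=
  (u.1.2 * v.2 - u.2 * v.1.2, u.2 * v.1.1 - u.1.1 * v.2,
   u.1.1 * v.1.2 - u.1.2 * v.1.1).

Lemma vdotC (u v : vec) : vdot u v = vdot v u.
Proof. by rewrite /vdot; ring. Qed.

Definition orthogonal_frame (b : vec * vec * vec) : bool :=
  let: (u, v, w) := b in
  [&& vdot u u != 0, vdot v v != 0, vdot w w != 0,
      vdot u v == 0, vdot u w == 0 & vdot v w == 0].

Lemma vcross_frame (u v : vec) : vdot u u != 0 -> vdot v v != 0 ->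
  vdot u v = 0 -> orthogonal_frame (u, v, vcross u v).
Proof.
move=> u0 v0 uv; rewrite /orthogonal_frame u0 v0 uv eqxx /=.
(* Lagrange's identity shows that the cross product is nonzero. *)
have -> : vdot (vcross u v) (vcross u v) = vdot u u * vdot v v - vdot u v ^+ 2.
  by rewrite /vdot /=; ring.
rewrite uv subr0 mulf_neq0 //=.
by apply/andP; split; apply/eqP; rewrite /vdot /=; ring.
Qed.

(* Picks one vector from each frame in all possible ways, pruning as soon as the
   new vector is orthogonal to an earlier one; [true] if every branch is pruned.
   The test is an [if] because [||] would make [vm_compute] evaluate both sides. *)
Fixpoint no_choice (bs : seq (vec * vec * vec)) (chosen : seq vec) : bool :=
  if bs is (u, v, w) :: bs' then
    all (fun x => if has (fun y => vdot x y == 0) chosen then true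
                  else no_choice bs' (x :: chosen)) [:: u; v; w]
  else false.

(* Found by computer search among the primitive vectors with entries in [-2, 2];
   the order of the frames keeps the search tree of [no_choice] small. *)
Definition ks_frames : seq (vec * vec * vec) := [::
  ((1, -1, 0), (1, 1, -1), (1, 1, 2)); ((0, 1, 1), (1, 1, -1), (2, -1, 1));
  ((0, 0, 1), (1, -1, 0), (1, 1, 0)); ((0, 0, 1), (0, 1, 0), (1, 0, 0));
  ((0, 1, -1), (0, 1, 1), (1, 0, 0)); ((0, 1, 0), (1, 0, -2), (2, 0, 1));
  ((1, -1, -2), (1, -1, 1), (1, 1, 0)); ((0, 1, 0), (1, 0, -1), (1, 0, 1));
  ((0, 1, -1), (1, -1, -1), (2, 1, 1)); ((1, -1, -1), (1, 0, 1), (1, 2, -1));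
  ((0, 1, 2), (0, 2, -1), (1, 0, 0)); ((0, 0, 1), (1, 2, 0), (2, -1, 0));
  ((1, -2, 1), (1, 0, -1), (1, 1, 1)); ((0, 0, 1), (1, -2, 0), (2, 1, 0));
  ((1, 2, -2), (2, -2, -1), (2, 1, 2)); ((0, 1, 0), (1, 0, 2), (2, 0, -1));
  ((1, 2, 2), (2, -2, 1), (2, 1, -2))].

Section KochenSpecker.
Variable c : vec -> Prop.
Hypothesis c_some :
  forall u v w, orthogonal_frame (u, v, w) -> [\/ c u, c v | c w].
Hypothesis c_orthogonal : forall u v,
  vdot u u != 0 -> vdot v v != 0 -> vdot u v = 0 -> c u -> c v -> False.

(** Following in each frame a vector satisfying [c] gives a branch that is never pruned, since no
    two such vectors are orthogonal. It would reach the empty list, where [no_choice] is [false]. *)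
Lemma no_choice_sound bs chosen :
  all orthogonal_frame bs -> no_choice bs chosen ->
  (forall y, y \in chosen -> vdot y y != 0 /\ c y) -> False.
Proof.
elim: bs chosen => //= -[[u v] w] bs IH chosen /andP[uvw bsP].
have [u0 v0 w0 _] := and4P uvw.
move=> /and4P[nu nv nw _] chosenP.
suff step z : vdot z z != 0 -> c z ->
    (if has (fun y => vdot z y == 0) chosen then true
     else no_choice bs (z :: chosen)) -> False.
  by case: (c_some uvw) => cz; [exact: step nu | exact: step nv | exact: step nw].
move=> z0 cz; case: hasP => [[y /chosenP[y0 cy] /eqP zy] _|_ nz].
  exact: c_orthogonal zy cz cy.
by apply: IH bsP nz _ => y; rewrite inE => /predU1P[->|/chosenP].
Qed.

Lemma kochen_specker : False.
Proof.
by apply: (@no_choice_sound ks_frames [::]); [vm_compute | vm_compute | ].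
Qed.

End KochenSpecker.

(** * Projections onto lines and orthogonal bases *)

(* The orthogonal projection onto the line of [v] when [v] is real and nonzero; no
   conjugation is needed for the integer vectors used below. *)
Definition mxproj (n : nat) (v : 'rV[C]_n) : 'M[C]_n :=
  ((v *m v^T) 0 0)^-1 *: (v^T *m v).

Lemma mxproj_idem (n : nat) (v : 'rV[C]_n) :
  (v *m v^T) 0 0 != 0 -> mxproj v *m mxproj v = mxproj v.
Proof.
rewrite /mxproj; set a := (v *m v^T) 0 0 => a0.
have -> : a^-1 *: (v^T *m v) *m (a^-1 *: (v^T *m v)) =
          (a^-1 * a^-1) *: (v^T *m (v *m v^T) *m v).
  by rewrite -scalemxAl -scalemxAr scalerA !mulmxA.
rewrite [v *m v^T]mx11_scalar -/a mul_mx_scalar -scalemxAl scalerA.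
by rewrite -mulrA mulVf // mulr1.
Qed.

Lemma mxproj_orth (n : nat) (v w : 'rV[C]_n) :
  v *m w^T = 0 -> mxproj v *m mxproj w = 0.
Proof.
move=> vw; rewrite /mxproj -scalemxAl -scalemxAr mulmxA -[v^T *m v *m _]mulmxA.
by rewrite vw mulmx0 mul0mx !scaler0.
Qed.

Lemma adjmx_proj (n : nat) (v : 'rV[C]_n) :
  map_mx conjc v = v -> adjmx (mxproj v) = mxproj v.
Proof.
move=> vr; have vTr : map_mx conjc v^T = v^T by rewrite -map_trmx vr.
have vvr : map_mx conjc (v *m v^T) = v *m v^T by rewrite map_mxM vr vTr.
rewrite /adjmx /mxproj linearZ /= map_mxZ trmx_mul trmxK map_mxM vr vTr.
congr (_ *: _); rewrite fmorphV; congr _^-1.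
by rewrite -[in RHS]vvr [RHS]mxE.
Qed.

Lemma sum_mxproj_basis (n : nat) (U : 'M[C]_n) :
  (forall i j, i != j -> row i U *m (row j U)^T = 0) ->
  (forall i, (row i U *m (row i U)^T) 0 0 != 0) ->
  \sum_i mxproj (row i U) = 1%:M.
Proof.
move=> Uo U0; pose d : 'rV[C]_n := \row_i (row i U *m (row i U)^T) 0 0.
have rowU i j : (U *m U^T) i j = (row i U *m (row j U)^T) 0 0.
  by rewrite !mxE; apply: eq_bigr => k _; rewrite !mxE.
(* With D the diagonal matrix of the squared lengths, U U^T = D, so U^T D^-1 is a right inverse of
   U. It is then a left inverse, and U^T D^-1 U is the sum of the projections. *)
have /mulmx1C <- : U *m (U^T *m diag_mx (map_mx (fun z => z^-1) d)) = 1%:M.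
  apply/matrixP => i j; rewrite mulmxA mul_mx_diag mxE rowU [map_mx _ _ 0 j]mxE.
  rewrite [d 0 j]mxE [RHS]mxE; have [<-|ij] := eqVneq i j.
    by rewrite divff ?U0.
  by rewrite Uo // mxE mul0r.
rewrite mul_mx_diag; apply/matrixP => i j; rewrite summxE mxE.
apply: eq_bigr => k _; rewrite mxE.
rewrite [X in _ = X * _](_ : _ = U k i * (d 0 k)^-1); last by rewrite 3!mxE.
by rewrite [d 0 k]mxE [X in _ * X = _]mxE big_ord1 !mxE mulrCA mulrA.
Qed.

(** * Integer vectors in a three-dimensional coordinate subspace *)

Definition vec_row (u : vec) : 'rV[C]_3 :=
  \row_j (nth 0 [:: u.1.1; u.1.2; u.2] j)%:~R.

Lemma vec_row_dot (u v : vec) : vec_row u *m (vec_row v)^T = (vdot u v)%:~R%:M.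
Proof.
apply/matrixP => i j; rewrite !ord1 !mxE !big_ord_recl big_ord0 !mxE /=.
by rewrite mulr1n addr0 !rmorphD !rmorphM /= addrA.
Qed.

Lemma vec_row_real (u : vec) : map_mx conjc (vec_row u) = vec_row u.
Proof. by apply/matrixP => i j; rewrite !mxE rmorph_int. Qed.

Section Embedding.
Variables (n : nat) (e : 'I_3 -> 'I_n).
Hypothesis e_inj : injective e.

Definition incl_mx : 'M[C]_(3, n) := \matrix_(i, j) (j == e i)%:R.

Lemma incl_mx_isometry : incl_mx *m incl_mx^T = 1%:M.
Proof.
apply/matrixP => i j; rewrite !mxE (bigD1 (e i)) //= !mxE eqxx mul1r big1.
  by rewrite addr0 (inj_eq e_inj).
by move=> k /negPf ki; rewrite !mxE ki mul0r.
Qed.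

Definition vec_emb (u : vec) : 'rV[C]_n := vec_row u *m incl_mx.

Lemma vec_emb_dot (u v : vec) : vec_emb u *m (vec_emb v)^T = (vdot u v)%:~R%:M.
Proof.
by rewrite trmx_mul mulmxA -(mulmxA (vec_row u)) incl_mx_isometry mulmx1 vec_row_dot.
Qed.

Lemma vec_emb_real (u : vec) : map_mx conjc (vec_emb u) = vec_emb u.
Proof.
rewrite map_mxM vec_row_real; congr (_ *m _).
by apply/matrixP => i j; rewrite !mxE rmorph_nat.
Qed.

Lemma mxproj_emb (u : vec) :
  mxproj (vec_emb u) = incl_mx^T *m mxproj (vec_row u) *m incl_mx.
Proof.
rewrite /mxproj vec_emb_dot vec_row_dot -scalemxAr -scalemxAl trmx_mul.
by rewrite !mulmxA.
Qed.

(** The right-hand side does not depend on [u]: all frames in the subspace share one complementary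
    projection. *)
Lemma sum_mxproj_emb (u : 'I_3 -> vec) :
  (forall i j, i != j -> vdot (u i) (u j) = 0) ->
  (forall i, vdot (u i) (u i) != 0) ->
  \sum_i mxproj (vec_emb (u i)) = incl_mx^T *m incl_mx.
Proof.
move=> uo u0.
under eq_bigr do rewrite mxproj_emb.
rewrite -mulmx_suml -mulmx_sumr.
under eq_bigr => i _ do rewrite -[vec_row _](rowK (fun i => vec_row (u i))).
rewrite sum_mxproj_basis ?mulmx1 // => [i j ij|i]; rewrite !rowK vec_row_dot.
  by rewrite uo // mulr0z raddf0.
by rewrite mxE eqxx mulr1n intr_eq0.
Qed.

End Embedding.

(** * Frames as partitions of unity, and the contradiction in M_n(C) *)

Lemma partition_complement (A : CStarAlg) (T : finType) (p : T -> A) :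
  (forall t, cs_star (p t) = p t) ->
  (forall s t, p s * p t = if s == t then p t else 0) ->
  partition_of_unity (fun o : option T => if o is Some t then p t else 1 - \sum_t p t).
Proof.
move=> pS pM; set q := \sum_t p t.
have pq t : p t * q = p t.
  rewrite mulr_sumr (bigD1 t) //= big1 ?addr0 ?pM ?eqxx // => s st.
  by rewrite pM eq_sym (negPf st).
have qp t : q * p t = p t.
  rewrite mulr_suml (bigD1 t) //= big1 ?addr0 ?pM ?eqxx // => s st.
  by rewrite pM (negPf st).
have qq : q * q = q by rewrite {1}/q mulr_suml; apply: eq_bigr.
split=> [[t|]|[s|] [t|]|] //.
- by rewrite cs_starD cs_starN cs_star1 cs_star_sum; under eq_bigr do rewrite pS.
- by rewrite mulrBr mulr1 pq subrr.
- by rewrite mulrBl mul1r qp subrr.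
- by rewrite eqxx mulrBr mulr1 mulrBl mul1r qq subrr subr0.
- rewrite (bigD1 None) //= (reindex_omap Some id) => [|[]] //=.
  by under eq_bigl do rewrite eqxx; rewrite subrK.
Qed.

Theorem theorem1p2 (F : CFunctor) :
  restricts_to_Gelf F ->
  forall (n : nat), (3 <= n)%N ->
  forall A : CStarAlg, is_Mn n A -> Fob F A -> False.
Proof.
move=> [eta [_ eta_nat]] n n3 A [phi [[psi phiK psiK]]].
move=> [phiD phiM phi1 _ phiS] x.
have psiD M N : psi (M + N) = psi M + psi N.
  by apply: (can_inj phiK); rewrite phiD !psiK.
have psi0 : psi 0 = 0 by apply: (addIr (psi 0)); rewrite -psiD !add0r.
have psi_sum (I : finType) (M : I -> 'M_n) : psi (\sum_i M i) = \sum_i psi (M i).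
  exact: (big_morph _ psiD psi0).
have psiM M N : psi (M *m N) = psi M * psi N.
  by apply: (can_inj phiK); rewrite phiM !psiK.
have psi1 : psi 1%:M = 1 by apply: (can_inj phiK); rewrite phi1 psiK.
have psiS M : cs_star (psi M) = psi (adjmx M).
  by apply: (can_inj phiK); rewrite phiS !psiK.
(* The diagonal matrix units form a partition of unity. *)
have [k vk] : exists k, valued eta x (psi (delta_mx k k)).
  apply: (valued_partition_ex eta_nat); split=> [k|i j|].
  - rewrite psiS; congr psi; apply/matrixP => i j.
    by rewrite !mxE rmorph_nat andbC.
  - by rewrite -psiM mul_delta_mx_cond; case: eqP => [->|]; rewrite ?psi0.
  - rewrite -psi_sum -psi1; congr psi; apply/matrixP => i j.
    rewrite summxE (bigD1 i) //= !mxE eqxx big1 ?addr0 1?eq_sym // => l li.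
    by rewrite mxE eq_sym (negPf li).
(* The transposition makes [e] send 0 to [k], so the subspace contains the valued line. *)
pose e i := tperm (widen_ord n3 ord0) k (widen_ord n3 i).
have e_inj : injective e by move=> i j /perm_inj/(congr1 (@nat_of_ord n))/= /ord_inj.
pose p u := psi (mxproj (vec_emb e u)).
have pS u : cs_star (p u) = p u.
  by rewrite psiS adjmx_proj // vec_emb_real.
have p_idem u : vdot u u != 0 -> p u * p u = p u.
  move=> u0; rewrite -psiM mxproj_idem // vec_emb_dot //.
  by rewrite mxE eqxx mulr1n intr_eq0.
have p_orth u v : vdot u v = 0 -> p u * p v = 0.
  by move=> uv; rewrite -psiM mxproj_orth // vec_emb_dot // uv mulr0z raddf0.
pose proj3 := psi ((incl_mx e)^T *m incl_mx e).
pose ext (u : 'I_3 -> vec) o := if o is Some i then p (u i) else 1 - proj3.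
have frameP (u : 'I_3 -> vec) : (forall i j, i != j -> vdot (u i) (u j) = 0) ->
    (forall i, vdot (u i) (u i) != 0) ->
    partition_of_unity (ext u).
  move=> uo u0; rewrite /ext /proj3 -(sum_mxproj_emb e_inj uo u0) psi_sum.
  apply: partition_complement => [i|i j]; first exact: pS.
  by have [<-|/uo/p_orth] := eqVneq i j; first exact: p_idem.
(* The standard frame [b] and the complement form a partition whose member at [ord0] is the valued
   matrix unit, so the complement is not valued. *)
have nproj3 : ~ valued eta x (1 - proj3).
  pose b (i : 'I_3) : vec :=
    ((i == 0 :> nat)%:R, (i == 1 :> nat)%:R, (i == 2 :> nat)%:R).
  have bP : partition_of_unity (ext b).
    by apply: frameP => [[[|[|[|]]] // hi] [[|[|[|]]] // hj]|[[|[|[|]]]]].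
  have p0 : p (b ord0) = psi (delta_mx k k).
    have vE : vec_emb e (b ord0) = delta_mx 0 k.
      apply/matrixP => i j; rewrite !mxE big_ord_recl big1 => [|l _].
        by rewrite !mxE /e tpermL addr0 mul1r ord1.
      by rewrite !mxE; case: l => -[|[|]] //= *; rewrite mul0r.
    rewrite /p /mxproj vE trmx_delta !mul_delta_mx !mxE !eqxx.
    by rewrite invr1 scale1r.
  move=> nm.
  have := valued_partition_inj eta_nat (x := x) (s := Some ord0) (t := None) bP.
  by rewrite /ext p0 => /(_ vk nm).
pose c u := valued eta x (p u).
have c_frame u v w : orthogonal_frame (u, v, w) ->
    [\/ c u, c v | c w] /\ ~ (c u /\ c v).
  move=> /and5P[u0 v0 w0 /eqP uv /andP[/eqP uw /eqP vw]].
  pose b (i : 'I_3) := nth u [:: u; v; w] i.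
  have bP : partition_of_unity (ext b).
    apply: frameP => [[[|[|[|]]] // hi] [[|[|[|]]] // hj]|[[|[|[|]]]]] //= _;
      by rewrite vdotC.
  split=> [|[cu cv]].
    (* Some member of the partition is valued; the index [None], the complement, is excluded by
       [nproj3]. *)
    have [[[[|[|[|//]]] hi]|] vi] := valued_partition_ex eta_nat x bP.
    - exact: Or31.
    - exact: Or32.
    - exact: Or33.
    - by case: nproj3.
  by have := valued_partition_inj eta_nat (x := x) (s := Some ord0)
               (t := Some (lift ord0 ord0)) bP cu cv.
apply: (@kochen_specker c) => [u v w /c_frame[]//|u v u0 v0 uv cu cv].
(* Two orthogonal vectors lie in a common frame, completed by their cross product, so they cannot
   both be valued. *)
by have [_] := c_frame _ _ _ (vcross_frame u0 v0 uv); apply.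
Qed.
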